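(* Refining forcing, i.e. the forcing consisting of Borel $\omega$-refining families ordered by inclusion, collapses the continuum to $\omega$ below some condition; that is, there is a condition $p$ forcing that the set of ground model reals $\omega^\omega\cap V$ is countable.
   Context: For $x,y\in[\omega]^\omega$, $y$ refines $x$ if $y\subseteq^*x$ or $y\subseteq^*\omega\setminus x$ (inclusion modulo finite sets). A family $B\subseteq[\omega]^\omega$ is $\omega$-refining if for every countable $C\subseteq[\omega]^\omega$ there is $y\in B$ that refines every $x\in C$. *)

(* Defs.v *)
From mathcomp Require Import all_boot.
From mathcomp Require Import boolp classical_sets cardinality topology cantor.
From mathcomp Require Import measurable_structure.

Set Implicit Arguments.
Unset Strict Implicit.
Unset Printing Implicit Defensive.

Local Open Scope classical_set_scope.

(** * Refining families *)

(* A subset of omega is identified with its characteristic function, so that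
   [omega]^omega inherits its topology from the Cantor space. *)
Definition supp (x : cantor_space) : set nat := [set n : nat | x n = true].

Definition infsets : set cantor_space := [set x | infinite_set (supp x)].

Definition almost_subset (a b : set nat) : Prop := finite_set (a `\` b).

Definition refines (y x : cantor_space) : Prop :=
  almost_subset (supp y) (supp x) \/ almost_subset (supp y) (~` supp x).

(* Only used for B `<=` infsets, see [condition]. *)
Definition omega_refining (B : set cantor_space) : Prop :=
  forall C : set cantor_space, C `<=` infsets -> countable C ->
    exists2 y, B y & forall x, C x -> refines y x.

Definition borel_set (T : topologicalType) (B : set T) : Prop :=
  <<s [set U : set T | open U] >> B.

(* As infsets is a G_delta subset of the Cantor space, its Borel subsets (for
   the subspace topology) are exactly the Borel subsets of the Cantor space
   that are included in infsets. *)
Record condition : Type := Condition {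
  family :> set cantor_space;
  family_infsets : family `<=` infsets;
  family_borel : borel_set family;
  family_refining : omega_refining family }.

(* [stronger p q]: p extends q in the forcing order. *)
Definition stronger (p q : condition) : Prop := family p `<=` family q.

(** * The ground model: well-founded sets, following Aczel *)

(* The set {e i | i : I}; distinct terms may denote the same set. *)
Inductive vset : Type := VSet (I : Type) (e : I -> vset).

Definition vempty : vset := VSet (fun i : False => match i with end).

(* {x, y} *)
Definition vpair (x y : vset) : vset :=
  VSet (fun b : bool => if b then x else y).

(* (x, y) = {{x}, {x, y}} *)
Definition vopair (x y : vset) : vset := vpair (vpair x x) (vpair x y).

(* x `|` {x} *)
Definition vsucc (x : vset) : vset :=
  let: VSet A e := x in
  VSet (fun o : option A => if o is Some i then e i else x).

Fixpoint vnat (n : nat) : vset := if n is m.+1 then vsucc (vnat m) else vempty.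

Definition vomega : vset := VSet vnat.

Definition vgraph (f : nat -> nat) : vset :=
  VSet (fun n => vopair (vnat n) (vnat (f n))).

(* omega^omega as computed in the ground model *)
Definition vbaire : vset := VSet vgraph.

(** * The language of set theory *)

(* Sentences with parameters in M, where quantifiers range over M; the
   connectives and quantifiers not listed are classical abbreviations. *)
Inductive formula (M : Type) : Type :=
| FMem of M & M
| FEq of M & M
| FNot of formula M
| FAnd of formula M & formula M
| FAll of (M -> formula M).

Definition FOr M (a b : formula M) := FNot (FAnd (FNot a) (FNot b)).
Definition FImp M (a b : formula M) := FNot (FAnd a (FNot b)).
Definition FIff M (a b : formula M) := FAnd (FImp a b) (FImp b a).
Definition FEx M (a : M -> formula M) := FNot (FAll (fun x => FNot (a x))).
Definition FAllIn M (X : M) (a : M -> formula M) :=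
  FAll (fun x => FImp (FMem x X) (a x)).
Definition FExIn M (X : M) (a : M -> formula M) :=
  FEx (fun x => FAnd (FMem x X) (a x)).

(* z = {x, y} *)
Definition is_pair M (z x y : M) : formula M :=
  FAll (fun w => FIff (FMem w z) (FOr (FEq w x) (FEq w y))).

(* z = (x, y) *)
Definition is_opair M (z x y : M) : formula M :=
  FEx (fun u => FEx (fun v =>
    FAnd (is_pair u x x) (FAnd (is_pair v x y) (is_pair z u v)))).

(* (x, y) \in f *)
Definition maps_to M (f x y : M) : formula M :=
  FExIn f (fun z => is_opair z x y).

(* f : X -> Y *)
Definition is_function M (f X Y : M) : formula M :=
  FAnd (FAllIn f (fun z => FExIn X (fun x => FExIn Y (fun y => is_opair z x y))))
  (FAnd (FAllIn X (fun x => FEx (fun y => maps_to f x y)))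
        (FAll (fun x => FAll (fun y => FAll (fun y' =>
           FImp (FAnd (maps_to f x y) (maps_to f x y')) (FEq y y')))))).

Definition is_injective M (f : M) : formula M :=
  FAll (fun x => FAll (fun x' => FAll (fun y =>
    FImp (FAnd (maps_to f x y) (maps_to f x' y)) (FEq x x')))).

(* X is countable, [om] being the set of natural numbers. *)
Definition is_countable M (om X : M) : formula M :=
  FEx (fun f => FAnd (is_function f X om) (is_injective f)).

(** * Forcing *)

(* The P-name {(t i, c i) | i : I}. *)
Inductive name (P : Type) : Type :=
  Name (I : Type) (t : I -> name P) (c : I -> P).

(* The canonical name of a ground model set. Members are paired with every
   condition, so that P need not come with a largest element. *)
Fixpoint check (P : Type) (x : vset) : name P :=
  let: VSet A e := x in
  Name (fun ip : A * P => check P (e ip.1)) (fun ip : A * P => ip.2).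

(* In what follows, [le p q] means that p extends q. The clauses for atomic
   sentences are the usual ones: p forces s = t iff below p every member of s
   is forced to be a member of t and conversely; p forces s \in t iff the r for
   which there is (t', d) in t with [le r d] and r forcing s = t' are dense
   below p. Membership is inlined in the clause for equality in order to make
   the recursion structural. *)
Fixpoint forces_eq (P : Type) (le : P -> P -> Prop) (s t : name P) (p : P) :
    Prop :=
  let: Name A s' c := s in
  let: Name B t' d := t in
  (forall i q, le q p -> le q (c i) ->
     exists2 r, le r q &
       exists2 j, le r (d j) & forces_eq le (s' i) (t' j) r) /\
  (forall j q, le q p -> le q (d j) ->
     exists2 r, le r q &
       exists2 i, le r (c i) & forces_eq le (s' i) (t' j) r).

Definition forces_mem (P : Type) (le : P -> P -> Prop) (s t : name P) (p : P) :
    Prop :=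
  let: Name B t' d := t in
  forall q, le q p ->
    exists2 r, le r q & exists2 j, le r (d j) & forces_eq le s (t' j) r.

Fixpoint forces (P : Type) (le : P -> P -> Prop) (p : P)
    (a : formula (name P)) : Prop :=
  match a with
  | FMem s t => forces_mem le s t p
  | FEq s t => forces_eq le s t p
  | FNot b => forall q, le q p -> ~ forces le q b
  | FAnd b b' => forces le p b /\ forces le p b'
  | FAll b => forall t : name P, forces le p (b t)
  end.

(* Main.v *)
(* Fix a perfect independent family (x_z), z in 2^omega, of subsets of omega. The
   condition is the set of those y such that, for each m, only finitely many z
   are such that y \ m is not split by x_z. If such a y refines x_z, then z is
   isolated, by some finite sequence t, among the points whose sets do not split
   y \ m, so that the pair (m, t) determines z from y. As x_z is refined by a
   member of each extension q of the condition, and as the ideal of the families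
   that are not omega-refining is a sigma-ideal, q has an extension on which
   (m, t) is constant. Hence z |-> (m, t) names an injection of the ground model
   reals into omega.

   The condition is omega-refining because the sets a such that (x_z), z notin E,
   is independent on a for some finite E are stable under passing to one of
   a `&` c and a `\` c. Given countably many sets c_k, this yields a decreasing
   sequence (a_k) deciding them, with an increasing sequence (E_k) of exceptions,
   and y is obtained by glueing finite pieces s_k of the a_k, where s_k is split
   by all x_z with z outside of a small neighbourhood of E_k. *)

Require Import Defs.
From mathcomp Require Import all_boot.
From mathcomp Require Import boolp classical_sets cardinality filter.
From mathcomp Require Import topology cantor measurable_structure.
Set Implicit Arguments.
Unset Strict Implicit.
Unset Printing Implicit Defensive.

Local Open Scope classical_set_scope.

(** * Forcing *)

Section Forcing.
Variables (P : Type) (le : P -> P -> Prop).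
Hypothesis le_refl : forall p, le p p.
Hypothesis le_trans : forall p q r, le p q -> le q r -> le p r.

Implicit Types (p q r : P) (s t u v w x y z : name P).
Implicit Types a b c : formula (name P).

Lemma forces_eq_mono s t p q :
  le q p -> forces_eq le s t p -> forces_eq le s t q.
Proof.
case: s => A s' c; case: t => B t' d /= qp [st ts].
by split=> i r rq; [apply: st|apply: ts]; exact: le_trans rq qp.
Qed.

Lemma forces_mem_mono s t p q :
  le q p -> forces_mem le s t p -> forces_mem le s t q.
Proof.
by case: t => B t' d /= qp st r rq; apply: st; exact: le_trans rq qp.
Qed.

Lemma forces_mono a p q : le q p -> forces le p a -> forces le q a.
Proof.
elim: a => [s t|s t|b _|b IHb c IHc|b IHb] /= qp.
- exact: forces_mem_mono.
- exact: forces_eq_mono.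
- by move=> nb r rq; apply: nb; exact: le_trans rq qp.
- by move=> [/(IHb qp) ? /(IHc qp)].
- by move=> H t; apply: IHb => //; exact: H.
Qed.

(** The atomic clauses ask for witnesses only densely below [p], so they absorb one more density; a
    negation survives because an extension forcing the negated formula would meet the dense set. The
    elimination rules below rest on this. *)
Lemma forces_dense a p :
  (forall q, le q p -> exists2 r, le r q & forces le r a) -> forces le p a.
Proof.
elim: a => [s t|s t|b _|b IHb c IHc|b IHb] /= H.
- case: t H => B t' d /= H q /H[r rq /(_ r (le_refl r))[r' r'r jP]].
  by exists r' => //; exact: le_trans rq.
- case: s t H => A s' c [B t' d] /= H.
  split=> i q /H[r rq [st ts]] qi.
    have [r' r'r jP] := st i r (le_refl r) (le_trans rq qi).
    by exists r' => //; exact: le_trans rq.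
  have [r' r'r jP] := ts i r (le_refl r) (le_trans rq qi).
  by exists r' => //; exact: le_trans rq.
- move=> q /H[r rq nb] qb; apply: (nb r (le_refl r)); exact: forces_mono qb.
- by split; [apply: IHb|apply: IHc] => q /H[r rq []]; exists r.
- by move=> t; apply: IHb => q /H[r rq]; exists r.
Qed.

Lemma forces_impI p a b :
  (forall q, le q p -> forces le q a -> forces le q b) ->
  forces le p (FImp a b).
Proof.
by move=> ab q qp [qa qnb]; exact: (qnb q (le_refl q)) (ab q qp qa).
Qed.

Lemma forces_impE p a b :
  forces le p (FImp a b) -> forces le p a -> forces le p b.
Proof.
move=> pab pa; apply: forces_dense => q qp; apply: contrapT => nb.
apply: (pab q qp); split; first exact: forces_mono pa.
by move=> r rq rb; apply: nb; exists r.
Qed.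

Lemma forces_iffI p a b :
  (forall q, le q p -> forces le q a <-> forces le q b) ->
  forces le p (FIff a b).
Proof. by move=> ab; split; apply: forces_impI => q /ab[]. Qed.

Lemma forces_iffE p a b :
  forces le p (FIff a b) -> forces le p a <-> forces le p b.
Proof. by case=> ab ba; split; exact: forces_impE. Qed.

Lemma forces_orIl p a b : forces le p a -> forces le p (FOr a b).
Proof.
by move=> pa q qp [na _]; apply: (na q (le_refl q)); exact: forces_mono pa.
Qed.

Lemma forces_orIr p a b : forces le p b -> forces le p (FOr a b).
Proof.
by move=> pb q qp [_ nb]; apply: (nb q (le_refl q)); exact: forces_mono pb.
Qed.

(** Only densely many extensions decide a disjunct, so the goal has to be a forced formula, which
    may be checked densely. The rules for existentials, members and pairs take the same form. *)
Lemma forces_orE p a b c : forces le p (FOr a b) ->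
  (forall q, le q p -> forces le q a -> forces le q c) ->
  (forall q, le q p -> forces le q b -> forces le q c) -> forces le p c.
Proof.
move=> pab ac bc; apply: forces_dense => q qp; apply: contrapT => nc.
apply: (pab q qp); split=> r rq rab; apply: nc; exists r => //.
  by apply: ac rab; exact: le_trans rq qp.
by apply: bc rab; exact: le_trans rq qp.
Qed.

Lemma forces_exI p (a : name P -> formula (name P)) t :
  forces le p (a t) -> forces le p (FEx a).
Proof.
by move=> pa q qp /(_ t q (le_refl q)); apply; exact: forces_mono pa.
Qed.

Lemma forces_exE p (a : name P -> formula (name P)) c :
  forces le p (FEx a) ->
  (forall q t, le q p -> forces le q (a t) -> forces le q c) -> forces le p c.
Proof.
move=> pa ac; apply: forces_dense => q qp; apply: contrapT => nc.
apply: (pa q qp) => t r rq ra; apply: nc; exists r => //.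
by apply: ac ra; exact: le_trans rq qp.
Qed.

Lemma forces_eq_refl s p : forces_eq le s s p.
Proof.
by elim: s p => A s' IH c p /=; split=> i q qp qi; exists q => //; exists i.
Qed.

Lemma forces_eq_sym s t p : forces_eq le s t p -> forces_eq le t s p.
Proof.
elim: s t p => A s' IH c [B t' d] p /= [st ts]; split=> i q qp qi.
  have [r rq [j rj ij]] := ts i q qp qi.
  by exists r => //; exists j => //; exact: IH.
have [r rq [j rj ij]] := st i q qp qi.
by exists r => //; exists j => //; exact: IH.
Qed.

Lemma forces_eq_trans s t u p :
  forces_eq le s t p -> forces_eq le t u p -> forces_eq le s u p.
Proof.
elim: s t u p => A s' IH c [B t' d] [C u' e] p /= [st ts] [tu ut].
split=> i q qp qi.
  have [r rq [j rj sij]] := st i q qp qi.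
  have [r' r'r [k rk tjk]] := tu j r (le_trans rq qp) rj.
  exists r'; first exact: le_trans rq.
  by exists k => //; apply: IH tjk; exact: forces_eq_mono sij.
have [r rq [j rj sij]] := ut i q qp qi.
have [r' r'r [k rk tjk]] := ts j r (le_trans rq qp) rj.
exists r'; first exact: le_trans rq.
by exists k => //; apply: IH tjk _; exact: forces_eq_mono sij.
Qed.

Lemma forces_memI p (B : Type) (t : B -> name P) (d : B -> P) j :
  le p (d j) -> forces_mem le (t j) (Name t d) p.
Proof.
move=> pj q qp; exists q => //; exists j; first exact: le_trans pj.
exact: forces_eq_refl.
Qed.

Lemma forces_memE p s (B : Type) (t : B -> name P) (d : B -> P) c :
  forces_mem le s (Name t d) p ->
  (forall q j, le q p -> le q (d j) -> forces_eq le s (t j) q ->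
    forces le q c) ->
  forces le p c.
Proof.
move=> st H; apply: forces_dense => q /[dup] qp /st[r rq [j rj stj]].
by exists r => //; apply: H stj => //; exact: le_trans qp.
Qed.

Lemma forces_mem_eql s s' t p :
  forces_eq le s s' p -> forces_mem le s t p -> forces_mem le s' t p.
Proof.
case: t => B t d ss' st q qp; have [r rq [j rj stj]] := st q qp.
exists r => //; exists j => //; apply: forces_eq_trans stj.
by apply/forces_eq_sym/(forces_eq_mono _ ss'); exact: le_trans qp.
Qed.

Lemma forces_mem_eqr s t t' p :
  forces_eq le t t' p -> forces_mem le s t p -> forces_mem le s t' p.
Proof.
case: t t' => A t c [B t' d] tt' st.
apply: (@forces_memE _ _ _ _ _ (FMem s (Name t' d)) st) => q i qp qi.
move=> /forces_eq_sym sti; apply: forces_mem_eql sti _.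
case: tt' => tt' _ r rq.
exact: (tt' i r (le_trans rq qp) (le_trans rq qi)).
Qed.

(** Induction on the name: if [s] belongs to itself, some extension equates it with one of its
    listed members, which then belongs to itself. *)
Lemma forces_mem_irr s p : ~ forces_mem le s s p.
Proof.
elim: s p => A s IH c p /[dup] ss /(_ p (le_refl p))[r rp [j rj sj]].
apply: (IH j r); apply: forces_mem_eqr sj _; exact: forces_memI.
Qed.

Lemma check_memI (A : Type) (e : A -> vset) i p :
  forces_mem le (check P (e i)) (check P (VSet e)) p.
Proof. 
by apply: (@forces_memI _ _ (fun ip : A * P => check P (e ip.1)) snd (i, p));
  exact: le_refl. Qed.

Lemma check_memE p s (A : Type) (e : A -> vset) c :
  forces_mem le s (check P (VSet e)) p ->
  (forall q i, le q p -> forces_eq le s (check P (e i)) q -> forces le q c) ->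
  forces le p c.
Proof.
by move=> se H; apply: forces_memE se _ => q [i r] /= qp _; exact: H.
Qed.

Lemma forces_allinI p X (a : name P -> formula (name P)) :
  (forall q t, le q p -> forces_mem le t X q -> forces le q (a t)) ->
  forces le p (FAllIn X a).
Proof.
by move=> H t; apply: (@forces_impI p (FMem t X) (a t)) => q qp; exact: H.
Qed.

Lemma forces_exinI p X (a : name P -> formula (name P)) t :
  forces_mem le t X p -> forces le p (a t) -> forces le p (FExIn X a).
Proof. by move=> tX pa; apply: (forces_exI (t := t)). Qed.

(** * Pairs *)

Lemma is_pairI p z x y :
  (forall q w, le q p ->
    forces_mem le w z q <-> forces le q (FOr (FEq w x) (FEq w y))) ->
  forces le p (is_pair z x y).
Proof.
move=> H w; apply: (@forces_iffI p (FMem w z) (FOr (FEq w x) (FEq w y))).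
by move=> q qp; exact: H.
Qed.

Lemma is_pair_memP p z x y w : forces le p (is_pair z x y) ->
  forces_mem le w z p <-> forces le p (FOr (FEq w x) (FEq w y)).
Proof.
by move=> zxy; apply: (@forces_iffE p (FMem w z) (FOr _ _)); exact: zxy.
Qed.

Lemma is_pair_meml p z x y : forces le p (is_pair z x y) -> forces_mem le x z p.
Proof.
move=> zxy; apply/(is_pair_memP x zxy)/forces_orIl; exact: forces_eq_refl.
Qed.

Lemma is_pair_memr p z x y : forces le p (is_pair z x y) -> forces_mem le y z p.
Proof.
move=> zxy; apply/(is_pair_memP y zxy)/forces_orIr; exact: forces_eq_refl.
Qed.

Lemma is_pair_eql p z z' x y : forces_eq le z z' p ->
  forces le p (is_pair z x y) -> forces le p (is_pair z' x y).
Proof.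
move=> zz' zxy; apply: is_pairI => q w qp; split.
  move=> wz'; apply/(is_pair_memP w (forces_mono qp zxy)).
  apply: forces_mem_eqr wz'; apply: forces_eq_sym; exact: forces_eq_mono zz'.
move=> /(is_pair_memP w (forces_mono qp zxy)) wz.
apply: forces_mem_eqr wz; exact: forces_eq_mono zz'.
Qed.

Lemma is_pair_inj p z x y x' y' c :
  forces le p (is_pair z x y) -> forces le p (is_pair z x' y') ->
  (forall q, le q p -> forces_eq le x x' q -> forces_eq le y y' q ->
    forces le q c) ->
  (forall q, le q p -> forces_eq le x y' q -> forces_eq le y x' q ->
    forces le q c) ->
  forces le p c.
Proof.
move=> zxy zxy' H1 H2.
have xx'y' := (is_pair_memP x zxy').1 (is_pair_meml zxy).
have yx'y' := (is_pair_memP y zxy').1 (is_pair_memr zxy).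
have x'xy := (is_pair_memP x' zxy).1 (is_pair_meml zxy').
have y'xy := (is_pair_memP y' zxy).1 (is_pair_memr zxy').
apply: (forces_orE xx'y') => q qp xE.
  apply: (forces_orE (forces_mono qp y'xy)) => r rq y'E.
    apply: (forces_orE (forces_mono (le_trans rq qp) yx'y')) => r' r'r yE.
      apply: H2 => //; first exact: le_trans (le_trans rq qp).
      by apply: forces_eq_mono (forces_eq_sym y'E).
    apply: H1 => //; first exact: le_trans (le_trans rq qp).
    by apply: (forces_eq_mono (le_trans r'r rq)).
  apply: H1; [exact: le_trans qp|exact: forces_eq_mono xE|].
  exact: forces_eq_sym.
apply: (forces_orE (forces_mono qp x'xy)) => r rq x'E.
  apply: (forces_orE (forces_mono (le_trans rq qp) yx'y')) => r' r'r yE.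
    apply: H2 => //; first exact: le_trans (le_trans rq qp).
    by apply: (forces_eq_mono (le_trans r'r rq)).
  apply: H1 => //; first exact: le_trans (le_trans rq qp).
  by apply: forces_eq_mono (forces_eq_sym x'E).
apply: H2; [exact: le_trans qp|exact: forces_eq_mono xE|].
exact: forces_eq_sym.
Qed.

Lemma is_opairE p z x y c : forces le p (is_opair z x y) ->
  (forall q u v, le q p -> forces le q (is_pair u x x) ->
    forces le q (is_pair v x y) -> forces le q (is_pair z u v) ->
    forces le q c) ->
  forces le p c.
Proof.
move=> zxy H; apply: (forces_exE zxy) => q u qp uP.
apply: (forces_exE uP) => r v rq [ux [vxy zuv]].
by apply: (H r u v) => //; exact: le_trans qp.
Qed.

Lemma is_opair_inj p z x y x' y' :
  forces le p (is_opair z x y) -> forces le p (is_opair z x' y') ->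
  forces_eq le x x' p /\ forces_eq le y y' p.
Proof.
move=> zxy zxy'.
(* The two equalities are read as one forced conjunction, so that the elimination rules apply. *)
apply: (is_opairE (c := FAnd (FEq x x') (FEq y y')) zxy).
move=> p2 u v p2p ux vxy zuv.
apply: (is_opairE (forces_mono p2p zxy')) => p4 u' v' p4p2 ux' vxy' zuv'.
have {}ux := forces_mono p4p2 ux.
have {}vxy := forces_mono p4p2 vxy.
have {}zuv := forces_mono p4p2 zuv.
apply: (is_pair_inj zuv zuv') => q qp4 uE vE.
  have {uE}ux'' := is_pair_eql uE (forces_mono qp4 ux).
  have {vE}vxy'' := is_pair_eql vE (forces_mono qp4 vxy).
  apply: (is_pair_inj ux'' (forces_mono qp4 ux')) => r rq xE _;
  apply: (is_pair_inj (forces_mono rq vxy'')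
                       (forces_mono (le_trans rq qp4) vxy'))
    => r' r'r xE' yE; split=> //; try exact: (forces_eq_mono r'r xE).
    apply: forces_eq_trans yE _; apply: forces_eq_trans xE'.
    by apply: forces_eq_sym; exact: (forces_eq_mono r'r xE).
  apply: forces_eq_trans yE _; apply: forces_eq_trans xE'.
  by apply: forces_eq_sym; exact: (forces_eq_mono r'r xE).
(* The crossed case {x} = {x', y'} and {x, y} = {x'}: all four components coincide. *)
have {uE}ux'' := is_pair_eql uE (forces_mono qp4 ux).
have {vE}vxy'' := is_pair_eql vE (forces_mono qp4 vxy).
apply: (is_pair_inj ux'' (forces_mono qp4 vxy')) => r rq xE xE';
apply: (is_pair_inj (forces_mono rq vxy'') (forces_mono (le_trans rq qp4) ux'))
    => r' r'r xE'' yE; split=> //; try exact: (forces_eq_mono r'r xE).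
- apply: forces_eq_trans yE _.
  apply: forces_eq_trans _ (forces_eq_mono r'r xE').
  exact: forces_eq_sym.
- apply: forces_eq_trans yE _.
  apply: forces_eq_trans _ (forces_eq_mono r'r xE').
  exact: forces_eq_sym.
- apply: forces_eq_trans yE _.
  apply: forces_eq_trans _ (forces_eq_mono r'r xE).
  exact: forces_eq_sym.
- apply: forces_eq_trans yE _.
  apply: forces_eq_trans _ (forces_eq_mono r'r xE).
  exact: forces_eq_sym.
Qed.

(** * Canonical names of pairs, numbers and functions *)

Lemma check_pair p (a b : vset) x y z : forces_eq le x (check P a) p ->
  forces_eq le y (check P b) p -> forces_eq le z (check P (vpair a b)) p ->
  forces le p (is_pair z x y).
Proof.
move=> xa yb zab; apply: is_pairI => q w qp; split.
  move=> /(forces_mem_eqr (forces_eq_mono qp zab)) wab.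
  apply: (check_memE wab) => r [] rq wE;
    [apply: forces_orIl|apply: forces_orIr];
    apply: forces_eq_trans wE _; apply: forces_eq_sym;
    [apply: forces_eq_mono xa|apply: forces_eq_mono yb]; exact: le_trans qp.
move=> wxy; apply: (@forces_mem_eqr _ (check P (vpair a b))).
  by apply: forces_eq_sym; exact: forces_eq_mono zab.
apply: (forces_orE (c := FMem w (check P (vpair a b))) wxy) => r rq wE.
  apply: (@forces_mem_eql (check P a)).
    apply: forces_eq_sym; apply: forces_eq_trans wE _.
    by apply: forces_eq_mono xa; exact: le_trans qp.
  exact: (@check_memI bool (fun i => if i then a else b) true).
apply: (@forces_mem_eql (check P b)).
  apply: forces_eq_sym; apply: forces_eq_trans wE _.
  by apply: forces_eq_mono yb; exact: le_trans qp.
exact: (@check_memI bool (fun i => if i then a else b) false).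
Qed.

Lemma check_opair p (a b : vset) x y z : forces_eq le x (check P a) p ->
  forces_eq le y (check P b) p -> forces_eq le z (check P (vopair a b)) p ->
  forces le p (is_opair z x y).
Proof.
move=> xa yb zab.
apply: (forces_exI (t := check P (vpair a a))).
apply: (forces_exI (t := check P (vpair a b))).
split; last split.
- exact: (check_pair xa xa (forces_eq_refl _ _)).
- exact: (check_pair xa yb (forces_eq_refl _ _)).
- exact: (check_pair (forces_eq_refl _ _) (forces_eq_refl _ _) zab).
Qed.

Lemma check_vnat_mem p m n :
  m < n -> forces_mem le (check P (vnat m)) (check P (vnat n)) p.
Proof.
have succ_mem q s (x : vset) : forces_mem le s (check P x) q ->
    forces_mem le s (check P (vsucc x)) q.
  case: x => A e sx.
  apply: (@check_memE q s A e (FMem s (check P (vsucc (VSet e)))) sx).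
  move=> r i rq si.
  apply: (@forces_mem_eql (check P (e i))); first exact: forces_eq_sym.
  exact: (@check_memI (option A)
    (fun o => if o is Some i then e i else VSet e) (Some i)).
elim: n => // n IH; rewrite ltnS leq_eqVlt => /predU1P[->|mn].
  rewrite /=; case: (vnat n) => A e.
  exact: (@check_memI (option A)
    (fun o => if o is Some i then e i else VSet e) None).
by apply: succ_mem; exact: IH.
Qed.

(** Of two distinct numbers one is a member of the other, so equating their names would contradict
    the irreflexivity of membership. *)
Lemma check_vnat_inj p m n :
  forces_eq le (check P (vnat m)) (check P (vnat n)) p -> m = n.
Proof.
case: (ltngtP m n) => // [mn|nm] eq_mn; exfalso.
  apply: (@forces_mem_irr (check P (vnat m)) p).
  by apply: forces_mem_eqr (check_vnat_mem p mn); exact: forces_eq_sym.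
apply: (@forces_mem_irr (check P (vnat n)) p).
exact: forces_mem_eqr (check_vnat_mem p nm).
Qed.

Lemma check_vgraph_inj p f g :
  forces_eq le (check P (vgraph f)) (check P (vgraph g)) p -> f = g.
Proof.
move=> fg; apply/funext => n.
have nf := @check_memI nat (fun n => vopair (vnat n) (vnat (f n))) n p.
have [r rp [[m r'] _ rE]] := forces_mem_eqr fg nf p (le_refl p).
have [nm fgn] : n = m /\ f n = g m.
  have [] := @is_opair_inj r (check P (vopair (vnat n) (vnat (f n))))
    (check P (vnat n)) (check P (vnat (f n)))
    (check P (vnat m)) (check P (vnat (g m))).
  - by apply: (@check_opair r (vnat n) (vnat (f n))); exact: forces_eq_refl.
  - apply: (@check_opair r (vnat m) (vnat (g m)));
      [exact: forces_eq_refl..|exact: rE].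
  - by move=> /check_vnat_inj-> /check_vnat_inj->.
by rewrite fgn nm.
Qed.

(** * Names for injections into omega *)

Section Collapse.
(** [D f n p] says that [p] admits [n] as an index of [f]. A condition may admit several indices for
    one function, but never one index for two functions. *)
Variable D : (nat -> nat) -> nat -> P -> Prop.
Hypothesis D_mono : forall f n p q, le q p -> D f n p -> D f n q.
Hypothesis D_inj : forall f g n p, D f n p -> D g n p -> f = g.

(* Deciding the least admissible index makes the name single-valued. *)
Let Dmin f n p := D f n p /\ forall m q, m < n -> le q p -> ~ D f m q.

Let F : name P := Name
  (fun i : {x : (nat -> nat) * nat * P | Dmin x.1.1 x.1.2 x.2} =>
    check P (vopair (vgraph (sval i).1.1) (vnat (sval i).1.2)))
  (fun i => (sval i).2).

Let F_memE p z c : forces_mem le z F p ->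
  (forall q f n, le q p -> Dmin f n q ->
    forces_eq le z (check P (vopair (vgraph f) (vnat n))) q -> forces le q c) ->
  forces le p c.
Proof.
move=> zF H; apply: (forces_memE zF) => q [[[f n] r] [Dfn Dm]] qp qr zE.
apply: (H q f n) => //; split; first exact: (D_mono (p := r)).
by move=> m s mn sq; apply: (Dm m s mn); exact: le_trans qr.
Qed.

Let F_maps_toE p x y c : forces le p (maps_to F x y) ->
  (forall q f n, le q p -> Dmin f n q ->
    forces_eq le x (check P (vgraph f)) q ->
    forces_eq le y (check P (vnat n)) q -> forces le q c) ->
  forces le p c.
Proof.
move=> pF H; apply: (forces_exE pF) => {pF} q z qp [zF zxy].
apply: (F_memE zF) => r f n rq Dn zE.
have [||xE yE] := @is_opair_inj r z x y (check P (vgraph f)) (check P (vnat n)).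
- exact: (@forces_mono (is_opair z x y) q r rq zxy).
- by apply: (@check_opair r (vgraph f) (vnat n)) zE; exact: forces_eq_refl.
by apply: (H r f n) => //; exact: le_trans qp.
Qed.

Let F_function p :
  (forall f q, le q p -> exists2 r, le r q & exists n, D f n r) ->
  forces le p (is_function F (check P vbaire) (check P vomega)).
Proof.
move=> D_dense; split; last split.
- apply: (forces_allinI (X := F)) => q z qp zF.
  apply: (F_memE zF) => r f n rq _ zE.
  apply: (forces_exinI (t := check P (vgraph f))).
    exact: (@check_memI _ vgraph).
  apply: (forces_exinI (t := check P (vnat n))).
    exact: (@check_memI _ vnat).
  by apply: (@check_opair r (vgraph f) (vnat n)) zE; exact: forces_eq_refl.
- apply: (forces_allinI (X := check P vbaire)) => q x qp xB.
  apply: (check_memE xB) => r f rq xf; apply: forces_dense => s sr.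
  have [/= n [s' [s's Dn]] nmin] : exists2 n,
      exists s' : P, le s' s /\ D f n s' &
      forall m, m < n -> ~ exists s' : P, le s' s /\ D f m s'.
    have exD : exists n, `[< exists s' : P, le s' s /\ D f n s' >].
      have [|s' s's [n Dn]] := D_dense f s.
        exact: le_trans sr (le_trans rq qp).
      by exists n; apply/asboolP; exists s'.
    exists (ex_minn exD); case: ex_minnP => n /asboolP // _ nmin m mn Dm.
    by move: mn; rewrite ltnNge nmin //; apply/asboolP.
  exists s' => //.
  apply: (@forces_exI s' (maps_to F x) (check P (vnat n))).
  apply: (forces_exinI (t := check P (vopair (vgraph f) (vnat n)))).
    have Dfn : Dmin f n s'.
      split=> // m t mn ts' Dm; apply: (nmin m mn); exists t; split=> //.
      exact: le_trans s's.
    exact: (@forces_memI _ _ _ _ (exist _ (f, n, s') Dfn)).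
  apply: (@check_opair s' (vgraph f) (vnat n)); [|exact: forces_eq_refl..].
  by apply: forces_eq_mono xf; exact: le_trans sr.
move=> x y y'.
apply: (@forces_impI p (FAnd (maps_to F x y) (maps_to F x y')) (FEq y y')).
move=> q qp [xy xy'].
apply: (F_maps_toE xy) => r f n rq [Dn nmin] xf yn.
apply: (F_maps_toE (@forces_mono (maps_to F x y') q r rq xy')).
move=> s g m sr [Dm mmin] xg ym.
have fg : f = g.
  apply: (@check_vgraph_inj s); apply: forces_eq_trans xg.
  by apply: forces_eq_sym; exact: forces_eq_mono xf.
rewrite -{}fg in Dm mmin.
have nm : n = m.
  case: (ltngtP n m) => // [nm|mn]; exfalso.
    by apply: (mmin n s nm) => //; exact: D_mono Dn.
  exact: (nmin m s mn sr Dm).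
rewrite -nm in ym.
apply: forces_eq_trans (forces_eq_sym ym); exact: forces_eq_mono yn.
Qed.

Let F_injective p : forces le p (is_injective F).
Proof.
move=> x x' y.
apply: (@forces_impI p (FAnd (maps_to F x y) (maps_to F x' y)) (FEq x x')).
move=> q qp [xy xy'].
apply: (F_maps_toE xy) => r f n rq [Dn _] xf yn.
apply: (F_maps_toE (@forces_mono (maps_to F x' y) q r rq xy')).
move=> s g m sr [Dm _] xg ym.
have nm : n = m.
  apply: (@check_vnat_inj s); apply: forces_eq_trans ym.
  by apply: forces_eq_sym; exact: forces_eq_mono yn.
rewrite -{}nm in Dm; rewrite -(D_inj (D_mono sr Dn) Dm) in xg.
apply: forces_eq_trans (forces_eq_sym xg); exact: forces_eq_mono xf.
Qed.

Lemma forces_is_countable p :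
  (forall f q, le q p -> exists2 r, le r q & exists n, D f n r) ->
  forces le p (is_countable (check P vomega) (check P vbaire)).
Proof.
move=> D_dense; apply: (forces_exI (t := F)); split.
  exact: F_function.
exact: F_injective.
Qed.

End Collapse.
End Forcing.

(** * Borel subsets of the Cantor space *)

Lemma borel_setC (T : topologicalType) (B : set T) :
  borel_set B -> borel_set (~` B).
Proof. by rewrite -setTD; exact: sigma_algebraCD. Qed.

Lemma borel_forall (T : topologicalType) (I : countType) (B : I -> set T) :
  (forall i, borel_set (B i)) -> borel_set [set y | forall i, B i y].
Proof.
move=> mB; rewrite (_ : mkset _ = ~` \bigcup_n [set y |
    if unpickle n is Some i then ~ B i y else False]); last first.
  apply/seteqP; split=> [y By [n _]|y nB i] /=.
    by case: unpickle => // i; apply; exact: By.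
  apply: contrapT => nBi; apply: nB; exists (pickle i) => //=.
  by rewrite pickleK.
apply: borel_setC; apply: sigma_algebra_bigcup => n.
case: unpickle => [i|]; first exact: borel_setC.
exact: sigma_algebra0.
Qed.

Lemma borel_exists (T : topologicalType) (I : countType) (B : I -> set T) :
  (forall i, borel_set (B i)) -> borel_set [set y | exists i, B i y].
Proof.
move=> mB.
rewrite (_ : mkset _ = ~` [set y | forall i, (~` B i) y]); last first.
  apply/seteqP; split=> [y [i Bi] /(_ i)|y /existsNP[i /contrapT]] //.
  by exists i.
by apply: borel_setC; apply: borel_forall => i; exact: borel_setC.
Qed.

Lemma borel_setI (T : topologicalType) (A B : set T) :
  borel_set A -> borel_set B -> borel_set (A `&` B).
Proof.
move=> mA mB.
rewrite (_ : A `&` B = [set y | forall b : bool, (if b then A else B) y]).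
  by apply: borel_forall => -[].
apply/seteqP; split=> [y [Ay By] []|y H] //.
by split; [exact: (H true)|exact: (H false)].
Qed.

Lemma borel_setU (T : topologicalType) (A B : set T) :
  borel_set A -> borel_set B -> borel_set (A `|` B).
Proof.
move=> mA mB; rewrite -(setCK (A `|` B)) setCU.
by apply: borel_setC; apply: borel_setI; exact: borel_setC.
Qed.

Lemma nbhs_mkseq (z : cantor_space) l :
  \forall y \near z, mkseq y l = mkseq z l.
Proof.
elim: l => [|l IH]; first by near=> y.
have zl : \forall y \near z, y l = z l.
  exact: (@proj_continuous nat (fun=> bool) l z [set z l]).
near=> y; rewrite !mkseqS; congr rcons; [near: y; exact: IH|near: y; exact: zl].
Unshelve. all: by end_near. Qed.

(** Membership depends on the first [l] values only, so the set is open. *)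
Lemma borel_mkseq (B : set cantor_space) l :
  (forall y z, mkseq y l = mkseq z l -> B y -> B z) -> borel_set B.
Proof.
move=> locB; apply: sub_sigma_algebra => /=; rewrite openE => y By.
apply: filterS (nbhs_mkseq y l) => z /esym yz; exact: locB By.
Qed.

Lemma borel_imply (T : topologicalType) (P : Prop) (B : set T) :
  (P -> borel_set B) -> borel_set [set y | P -> B y].
Proof.
move=> mB; have [p|np] := pselect P.
  rewrite (_ : mkset _ = B); first exact: mB.
  by apply/seteqP; split=> [y /(_ p)|y By _].
rewrite (_ : mkset _ = setT); first by apply: sub_sigma_algebra; exact: openT.
by apply/seteqP; split=> [//|y _ /np].
Qed.

Lemma eq_mkseqP T l (y z : nat -> T) :
  mkseq y l = mkseq z l <-> forall i, i < l -> y i = z i.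
Proof.
split=> [yz i il|yz]; last by apply/eq_in_map => i; rewrite mem_iota => /yz.
by rewrite -(nth_mkseq (y i) y il) yz nth_mkseq.
Qed.

Lemma mkseq_le T l m (y z : nat -> T) :
  l <= m -> mkseq y m = mkseq z m -> mkseq y l = mkseq z l.
Proof.
move=> lm /eq_mkseqP yz; apply/eq_mkseqP => i il.
by apply: yz; exact: leq_trans lm.
Qed.

Lemma mkseqD T l m (z : nat -> T) :
  mkseq z (l + m) = mkseq z l ++ mkseq (fun i => z (l + i)) m.
Proof.
by rewrite /mkseq iotaD map_cat add0n -{2}(addn0 l) iotaDl -map_comp.
Qed.

Lemma separation (Z : seq cantor_space) : exists d, forall e, d <= e ->
  {in Z &, forall u v, mkseq u e = mkseq v e -> u = v}.
Proof.
have /choice[d dP] : forall uv : cantor_space * cantor_space, exists d,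
    mkseq uv.1 d = mkseq uv.2 d -> uv.1 = uv.2.
  move=> [u v] /=.
  have [->|/eqP uv] := eqVneq u v; first by exists 0.
  have [n un] : exists n, u n <> v n.
    by apply/existsNP => un; apply: uv; apply/funext.
  exists n.+1 => /eq_mkseqP/(_ n (leqnn _)) //.
exists (\max_(u <- Z) \max_(v <- Z) d (u, v)) => e de u v uZ vZ uv.
apply: (dP (u, v)); apply: mkseq_le uv => /=.
apply: leq_trans de; apply: (leq_trans _ (leq_bigmax_seq _ uZ isT)).
exact: (@leq_bigmax_seq _ _ xpredT (fun v => d (u, v)) v vZ).
Qed.

Lemma finite_nat_bound (A : set nat) :
  finite_set A <-> exists n, forall i, A i -> i < n.
Proof.
split=> [/finite_seqP[s ->]|[n An]].
  exists (\max_(i <- s) i).+1 => i is_; rewrite ltnS.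
  exact: (@leq_bigmax_seq _ _ xpredT id _ is_).
exact: sub_finite_set An (finite_II n).
Qed.

(** * An independent family *)

(* The number i codes a pair (ts, _), and belongs to [indep z] iff z extends
   an element of ts. The second component provides each ts with infinitely many
   codes. *)
Definition indep (z : cantor_space) : cantor_space := fun i =>
  if unpickle i : option (seq (seq bool) * nat) is Some (ts, _)
  then has (fun s => mkseq z (size s) == s) ts else false.

(** A code lists finitely many sequences, whose maximal length bounds what is read of [z]. The
    compactness argument in [good_block] needs this continuity. *)
Lemma indep_local i : exists l, forall y z,
  mkseq y l = mkseq z l -> indep y i = indep z i.
Proof.
rewrite /indep; case: unpickle => [[ts _]|]; last by exists 0.
exists (\max_(s <- ts) size s) => y z yz; apply: eq_in_has => s tss.
by rewrite (mkseq_le _ yz) //; exact: (@leq_bigmax_seq _ _ xpredT size).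
Qed.

Lemma injective_unbounded (f : nat -> nat) N :
  injective f -> exists n, N <= f n.
Proof.
move=> injf; apply: contrapT => /forallNP fN.
have := @uniq_leq_size _ (map f (iota 0 N.+1)) (iota 0 N).
rewrite map_inj_uniq // iota_uniq size_map !size_iota ltnn => H.
apply: notF; apply: H => // _ /mapP[n _ ->]; rewrite mem_iota /= ltnNge.
by apply/negP; exact: fN.
Qed.

(* The family of the [indep z] for z outside of E is independent on a. *)
Definition good (a : set nat) (E : seq cantor_space) :=
  forall (Z : seq cantor_space) (g : cantor_space -> bool) N,
    (forall z, z \in Z -> z \notin E) ->
    exists2 i, N <= i & a i /\ {in Z, forall z, indep z i = g z}.

Lemma good_setT : good setT [::].
Proof.
move=> Z g N _; have [l lZ] := separation Z.
(* At a level separating [Z], the code lists the initial segments of the points where [g] is true;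
   its second component then lifts it above [N]. *)
pose ts := [seq mkseq z l | z <- [seq z <- Z | g z]].
have [|n Nn] := @injective_unbounded (fun n => pickle (ts, n)) N.
  by move=> m n /(pcan_inj pickleK)[].
exists (pickle (ts, n)) => //; split=> // z zZ; rewrite /indep pickleK has_map.
apply/hasP/idP => /= [[y]|gz].
  rewrite mem_filter size_mkseq => /andP[gy yZ] /eqP zy.
  by rewrite (lZ l (leqnn l) z y).
by exists z; rewrite ?mem_filter ?gz // size_mkseq.
Qed.

(** A failure inside [c] is a pattern [g] on a finite [Z] that is not realized there beyond [N].
    With [Z] made exceptional, [g] can be required along with any pattern off [E ++ Z]; the points
    of [a] so obtained lie outside [c]. *)
Lemma good_split a E (c : set nat) : good a E ->
  good (a `&` c) E \/ exists2 F, {subset E <= F} & good (a `\` c) F.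
Proof.
move=> gaE; have [|ngc] := pselect (good (a `&` c) E); [by left|right].
move: ngc => /existsNP[Z /existsNP[g /existsNP[N /not_implyP[ZE nZ]]]].
exists (E ++ Z) => [z zE|]; first by rewrite mem_cat zE.
move=> Z' g' N' Z'E.
have [|i Ni [ai iZ]] := gaE (Z ++ Z') (fun z => if z \in Z then g z else g' z)
    (maxn N N').
  move=> z; rewrite mem_cat => /orP[/ZE//|/Z'E].
  by rewrite mem_cat negb_or => /andP[].
move: Ni; rewrite geq_max => /andP[Ni N'i].
have [ci|nci] := pselect (c i).
  case: nZ; exists i => //; split=> // z zZ.
  by rewrite iZ ?mem_cat ?zZ.
exists i => //; split=> // z zZ'; rewrite iZ ?mem_cat ?zZ' ?orbT //.
by have := Z'E _ zZ'; rewrite mem_cat negb_or => /andP[_ /negbTE ->].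
Qed.

Lemma good_infinite a E N : good a E -> exists2 i, N <= i & a i.
Proof. by move=> /(_ [::] xpredT N)[] // i Ni [ai _]; exists i. Qed.

Lemma indep_infsets z : infsets (indep z).
Proof.
move=> /finite_nat_bound[N zN].
have [//|i Ni [_ zi]] := good_setT (Z := [:: z]) (fun=> true) N.
by have := zN i (zi z (mem_head _ _)); rewrite ltnNge Ni.
Qed.

(** * Splitting *)

Definition split_by (y : set nat) m n (z : cantor_space) := exists i j,
  [/\ m <= i < n, m <= j < n, y i, y j & indep z i && ~~ indep z j].

(** For [z] outside [E], [indep z] takes both values on [a] beyond [m], and by [indep_local] the
    same two witnesses serve the neighbours of [z]; compactness of the Cantor space then gives a
    single bound [n]. *)
Lemma good_block a E d m : good a E -> exists2 n, m < n &
  (exists2 i, m <= i < n & a i) /\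
  forall z, (forall v, v \in E -> mkseq z d <> mkseq v d) -> split_by a m n z.
Proof.
move=> gaE.
(* The first alternative takes care of the neighbourhoods of the points of [E], so that the whole
   compact space is covered. *)
have /compact_near_coveringP/(_ _ \oo (fun n z =>
    (exists2 v, v \in E & mkseq z d = mkseq v d) \/ split_by a m n z)) :=
  cantor_space_compact.
case=> [z _|N _ NP].
  have [zE|nzE] := pselect (exists2 v, v \in E & mkseq z d = mkseq v d).
    have [v vE zv] := zE.
    exists ([set y | mkseq y d = mkseq z d], setT) => /=.
      by split; [exact: nbhs_mkseq|exact: filterT].
    by move=> [y n] /= [yz _]; left; exists v => //; rewrite yz.
  have nZE y : y \in [:: z] -> y \notin E.
    rewrite inE => /eqP ->; by apply/negP => zE; apply: nzE; exists z.
  have [i mi [ai zi]] := gaE _ (fun=> true) m nZE.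
  have [j mj [aj zj]] := gaE _ (fun=> false) m nZE.
  have [li liP] := indep_local i; have [lj ljP] := indep_local j.
  exists ([set y | mkseq y (maxn li lj) = mkseq z (maxn li lj)],
          [set n | maxn i j < n]) => /=.
    by split; [exact: nbhs_mkseq|exact: nbhs_infty_gt].
  move=> [y n] /= [yz]; rewrite gtn_max => /andP[ni nj]; right; exists i, j.
  split=> //; [by rewrite mi|by rewrite mj|].
  rewrite (liP y z) ?(ljP y z) ?zi ?zj ?mem_head //.
    exact: (mkseq_le (leq_maxr _ _) yz).
  exact: (mkseq_le (leq_maxl _ _) yz).
(* The bound also passes a member of [a]: nonempty blocks will make the glued set infinite. *)
have [i mi ai] := good_infinite m gaE.
exists (maxn N i.+1); first by rewrite leq_max ltnS mi orbT.
split; first by exists i; rewrite // mi leq_max ltnSn orbT.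
move=> z zE; by have [[v vE /(zE v vE)]|] := NP _ (leq_maxl N i.+1) z I.
Qed.

(** * The condition *)

Definition splits_cylinder m n (s : seq bool) : set cantor_space :=
  [set y | forall z, mkseq z (size s) = s -> split_by (supp y) m n z].

Definition unsplit m z : set cantor_space :=
  [set y | forall i j, m <= i -> m <= j -> y i -> y j -> indep z i = indep z j].

(* By compactness, y is in [isolating m t] iff there is at most one extension z
   of t such that y is in [unsplit m z]; the present form is visibly Borel. *)
Definition isolating m (t : seq bool) : set cantor_space :=
  [set y | forall u v, size u = size v -> u <> v ->
    exists n, splits_cylinder m n (t ++ u) y \/ splits_cylinder m n (t ++ v) y].

Definition codes z m (t : seq bool) : set cantor_space :=
  [set y | [/\ mkseq z (size t) = t, unsplit m z y & isolating m t y]].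

(** There are finitely many [t] of length [l], each with at most one unsplit extension; a common
    level [l] thus expresses that only finitely many [indep z] fail to split [y] beyond [m]. *)
Definition thin : set cantor_space :=
  infsets `&`
  [set y | forall m, exists l, forall t, size t = l -> isolating m t y].

(** Distinct [z] and [z'] would extend [t] by different tails of equal length; [isolating] splits
    one of the two cylinders throughout, against [unsplit] for the point in it. *)
Lemma codes_inj z z' m t y : codes z m t y -> codes z' m t y -> z = z'.
Proof.
move=> [zt zy ty] [z't z'y _]; apply: contrapT => zz'.
have [n zn] : exists n, z n <> z' n.
  by apply/existsNP => zn; apply: zz'; apply/funext.
(* The length [n.+1] makes [t ++ r x] reach past coordinate [n], whatever the length of [t]. *)
pose r (x : cantor_space) := mkseq (fun i => x (size t + i)) n.+1.
have rE x : mkseq x (size t) = t -> mkseq x (size (t ++ r x)) = t ++ r x.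
  by move=> xt; rewrite size_cat size_mkseq mkseqD xt.
have rr : r z <> r z'.
  move=> rr; apply: zn.
  have : mkseq z (size t + n.+1) = mkseq z' (size t + n.+1).
    by rewrite !mkseqD zt z't -/(r z) rr.
  by move=> /eq_mkseqP; apply; rewrite addnS ltnS leq_addl.
have unsplitN x k : unsplit m x y -> mkseq x (size t) = t ->
    ~ splits_cylinder m k (t ++ r x) y.
  move=> xy xt /(_ x (rE x xt))[i [j [/andP[mi _] /andP[mj _] yi yj]]].
  by rewrite (xy i j) // andbN.
have rr_size : size (r z) = size (r z') by rewrite !size_mkseq.
by have [k [/unsplitN|/unsplitN]] := ty _ _ rr_size rr; apply.
Qed.

(** An almost inclusion becomes exact beyond some [m], where [indep z] is then constant on [y]; [t]
    is the initial segment of [z] at the level that [thin] provides for [m]. *)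
Lemma refines_codes z y :
  thin y -> refines y (indep z) -> exists m t, codes z m t y.
Proof.
move=> [_ thin_y] yz; have [m zy] : exists m, unsplit m z y.
  case: yz => /finite_nat_bound[m ym]; exists m => i j mi mj yi yj.
    have H k : m <= k -> y k -> indep z k.
      move=> mk yk; apply: contrapT => nzk.
      by have := ym k (conj yk nzk); rewrite ltnNge mk.
    by rewrite !H.
  have H k : m <= k -> y k -> indep z k = false.
    move=> mk yk; apply/negP => zk.
    by have := ym k (conj yk (fun f => f zk)); rewrite ltnNge mk.
  by rewrite !H.
have [l yl] := thin_y m.
exists m, (mkseq z l); split=> //; first by rewrite size_mkseq.
by apply: yl; rewrite size_mkseq.
Qed.

(** * Borel complexity of the condition *)

Lemma borel_splits_cylinder m n s : borel_set (splits_cylinder m n s).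
Proof.
(* Only the values of [y] below [n] matter, uniformly in [z], so the quantifier over uncountably
   many [z] is harmless. *)
apply: (@borel_mkseq _ n) => y y' /eq_mkseqP yy' ys z /ys[i [j []]].
move=> /andP[mi ni] /andP[mj nj] yi yj zij; exists i, j.
by rewrite mi mj ni nj /supp /= -!yy'.
Qed.

Lemma borel_isolating m t : borel_set (isolating m t).
Proof.
apply: borel_forall => u; apply: borel_forall => v.
apply: borel_imply => _; apply: borel_imply => _; apply: borel_exists => n.
by apply: borel_setU; exact: borel_splits_cylinder.
Qed.

Lemma borel_codes z m t : borel_set (codes z m t).
Proof.
(* The requirement on [z] and [t] does not involve [y]: the second factor is the whole space if it
   holds and empty otherwise. *)
rewrite (_ : codes z m t =
  [set y | mkseq z (size t) = t -> (unsplit m z `&` isolating m t) y] `&`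
  ~` [set y | mkseq z (size t) = t -> set0 y]); last first.
  apply/seteqP; split=> [y [zt zy ty]|y [+ nzt]].
    by split=> [_|/(_ zt)].
  have [zt /(_ zt)[zy ty]|zt] := pselect (mkseq z (size t) = t); first by split.
  by exfalso; exact: nzt.
apply: borel_setI; last first.
  by apply: borel_setC; apply: borel_imply => _; exact: sigma_algebra0.
apply: borel_imply => _; apply: borel_setI; last exact: borel_isolating.
apply: borel_forall => i; apply: borel_forall => j.
do 2 apply: borel_imply => _.
apply: (@borel_mkseq _ (maxn i j).+1) => y y' /eq_mkseqP yy' /=.
by rewrite !yy' // ltnS ?leq_maxl ?leq_maxr.
Qed.

Lemma borel_thin : borel_set thin.
Proof.
apply: borel_setI; last first.
  apply: borel_forall => m; apply: borel_exists => l; apply: borel_forall => t.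
  by apply: borel_imply => _; exact: borel_isolating.
rewrite (_ : infsets =
    ~` [set y : cantor_space | exists n, forall i : nat, y i -> i < n]).
  apply: borel_setC; apply: borel_exists => n; apply: borel_forall => i.
  by apply: (@borel_mkseq _ i.+1) => y z /eq_mkseqP yz /=; rewrite (yz i).
apply/seteqP; split=> y ny; last by move=> /finite_nat_bound.
by move=> yn; apply: ny; apply/finite_nat_bound.
Qed.

(** * The condition is omega-refining *)

Lemma good_sequence (c : nat -> set nat) : exists (a : nat -> set nat)
    (E : nat -> seq cantor_space), forall k,
  [/\ good (a k) (E k), a k.+1 `<=` a k, {subset E k <= E k.+1} &
      a k.+1 `<=` c k \/ a k.+1 `<=` ~` c k].
Proof.
pose state := {s : set nat * seq cantor_space | good s.1 s.2}.
have /choice[next nextP] : forall sk : state * nat, exists s' : state,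
    [/\ (sval s').1 `<=` (sval sk.1).1, {subset (sval sk.1).2 <= (sval s').2} &
      (sval s').1 `<=` c sk.2 \/ (sval s').1 `<=` ~` c sk.2].
  move=> [[[a E] /= gaE] k]; have [gac|[F EF gac]] := good_split (c k) gaE.
    exists (exist _ (a `&` c k, E) gac) => /=.
    by split=> [i []||] //; left => i [].
  exists (exist _ (a `\` c k, F) gac) => /=.
  by split=> [i []||] //; right => i [].
pose st := fix st k : state := if k is k'.+1 then next (st k', k')
  else exist _ (setT, [::]) good_setT.
exists (fun k => (sval (st k)).1), (fun k => (sval (st k)).2) => k.
have [? ? ?] := nextP (st k, k).
by split=> //; exact: (svalP (st k)).
Qed.

Lemma thin_omega_refining : omega_refining thin.
Proof.
move=> C Cinf /countable_injP[f injf].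
(* An enumeration of [C]; numbers outside the range of [f] on [C] get a default point, and deciding
   that set too does no harm. *)
pose c n := xget point [set x | C x /\ f x = n].
have cf x : C x -> c (f x) = x.
  move=> Cx; rewrite /c; case: xgetP => [y _ [Cy fyx]|/(_ x)]; last by case.
  by apply: injf => //; rewrite inE.
have [a [E aE]] := good_sequence (supp \o c).
have a_le j k : j <= k -> a k `<=` a j.
  elim: k => [|k IH]; first by rewrite leqn0 => /eqP ->.
  rewrite leq_eqVlt => /predU1P[->//|/IH]; apply: subset_trans.
  by have [] := aE k.
have E_le j k : j <= k -> {subset E j <= E k}.
  elim: k => [|k IH]; first by rewrite leqn0 => /eqP ->.
  rewrite leq_eqVlt => /predU1P[->//|/IH Ejk] v /Ejk.
  by have [_ _ + _] := aE k; exact.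
have /choice[e eP] := fun k => separation (E k.+1).
(* Choosing d k after E k.+1 keeps the later exceptions away from the small
   neighbourhood of E k, so that no new point is exceptional at all stages. *)
pose d k := \sum_(i < k.+1) (e i).+1.
have dS k : d k.+1 = d k + (e k.+1).+1 by rewrite /d big_ord_recr.
have d_le j k : j <= k -> d j <= d k.
  elim: k => [|k IH]; first by rewrite leqn0 => /eqP ->.
  rewrite leq_eqVlt => /predU1P[->//|/IH /leq_trans]; apply.
  by rewrite dS leq_addr.
have k_le_d k : k <= d k.
  by elim: k => // k IH; rewrite dS addnS ltnS (leq_trans IH) ?leq_addr.
have dP k : {in E k.+1 &,
    forall u v, mkseq u (d k) = mkseq v (d k) -> u = v}.
  apply: eP; rewrite /d big_ord_recr /=.
  by rewrite (leq_trans (leqnSn _)) ?leq_addl.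
have /choice[nxt nxtP] : forall km : nat * nat, exists n, km.2 < n /\
    (exists2 i, km.2 <= i < n & a km.1 i) /\ forall z,
    (forall v, v \in E km.1 -> mkseq z (d km.1) <> mkseq v (d km.1)) ->
    split_by (a km.1) km.2 n z.
  move=> [k m]; have [gaE _ _ _] := aE k.
  by have [n mn nP] := good_block (d k) m gaE; exists n.
pose M := fix M k := if k is k'.+1 then nxt (k', M k') else 0.
have M_lt k : M k < M k.+1 by have [] := nxtP (k, M k).
have M_le j k : j <= k -> M j <= M k.
  elim: k => [|k IH]; first by rewrite leqn0 => /eqP ->.
  rewrite leq_eqVlt => /predU1P[->//|/IH /leq_trans]; apply; exact: ltnW.
have k_le_M k : k <= M k by elim: k => // k IH; exact: leq_ltn_trans IH _.
pose y : cantor_space := fun i => `[< exists2 k, M k <= i < M k.+1 & a k i >].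
have ya k i : M k <= i -> y i -> a k i.
  move=> Mi /asboolP[j /andP[_ ij]]; apply: a_le; rewrite -ltnS ltnNge.
  by apply/negP => /M_le; rewrite leqNgt (leq_ltn_trans Mi ij).
have ysplit k z : (forall v, v \in E k -> mkseq z (d k) <> mkseq v (d k)) ->
    split_by (supp y) (M k) (M k.+1) z.
  have [_ [_ H]] := nxtP (k, M k) => /H[i [j [iM jM ai aj zij]]].
  by exists i, j; split=> //; apply/asboolP; exists k.
exists y; last first.
  (* [x] is [c (f x)], decided by [a (f x).+1], which contains [y] beyond [M (f x).+1]. *)
  move=> x Cx; have [_ _ _] := aE (f x).
  rewrite /= cf // => -[ax|ax]; [left|right];
    apply/finite_nat_bound; exists (M (f x).+1) => i [yi nxi];
    by rewrite ltnNge; apply/negP => /ya/(_ yi)/ax.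
split=> [/finite_nat_bound[n yn]|m].
  have [_ [[i /andP[Mi iM] ai] _]] := nxtP (n, M n).
  have : y i by apply/asboolP; exists n; rewrite //= Mi.
  by move=> /yn; rewrite ltnNge (leq_trans (k_le_M n) Mi).
exists (d m) => t tm u v uv_size uv.
(* The common length of [t ++ u] and [t ++ v]. Since [k <= d k], approximation at stage [k]
   determines both sequences. *)
pose k := d m + size u.
have mk : m <= k by rewrite (leq_trans (k_le_d m)) ?leq_addr.
(* If [z] is not split, it agrees up to [d j] with a point of [E j] at each stage [j]. As [d j]
   separates [E j.+1], the approximating point cannot change and stays in [E m]. *)
have near_E z : ~ split_by (supp y) m (M k.+1) z -> forall j, m <= j <= k ->
    exists2 w, w \in E m & mkseq z (d j) = mkseq w (d j).
  move=> nz.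
  have zE j : m <= j <= k ->
      exists2 w, w \in E j & mkseq z (d j) = mkseq w (d j).
    move=> /andP[mj jk]; apply: contrapT => /forall2NP zE; apply: nz.
    have [|i [i' [/andP[ji ij] /andP[ji' i'j] yi yi' zi]]] := ysplit j z.
      by move=> w wE zw; have [] := zE w.
    exists i, i'; split=> //; apply/andP; split.
    - exact: leq_trans (leq_trans mj (k_le_M j)) ji.
    - by apply: leq_trans ij _; exact: M_le.
    - exact: leq_trans (leq_trans mj (k_le_M j)) ji'.
    - by apply: leq_trans i'j _; exact: M_le.
  elim=> [|j IH] /andP[mj jk].
    by move: mj; rewrite leqn0 => /eqP m0; rewrite m0 in zE *; exact: zE.
  move: mj; rewrite leq_eqVlt => /predU1P[<-|mj].
    by apply: zE; rewrite leqnn.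
  have [|w wE zw] := IH; first by rewrite -ltnS mj ltnW.
  have [|w' wE' zw'] := zE j.+1; first by rewrite ltnW.
  exists w => //; rewrite zw'; congr mkseq; apply: (dP j) => //.
    by apply: E_le wE; rewrite ltnW.
  by rewrite -zw; apply/esym; apply: mkseq_le zw'; exact: d_le.
(* Otherwise each cylinder contains an unsplit point. The points of [E m] close to these agree up to
   [d m], the length of [t], so they coincide, whence [u = v]. *)
exists (M k.+1); apply: contrapT => /not_orP[].
move=> /existsNP[z /not_implyP[zu /near_E zE]].
move=> /existsNP[z' /not_implyP[z'v /near_E z'E]].
have [|w wE zw] := zE k; first by rewrite mk /=.
have [|w' w'E z'w'] := z'E k; first by rewrite mk /=.
have prefix_k (x x' : cantor_space) :
    mkseq x (d k) = mkseq x' (d k) -> mkseq x k = mkseq x' k.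
  exact: mkseq_le.
move: zu z'v; rewrite !size_cat -uv_size tm => zu z'v.
have ww' : w = w'.
  apply: (dP m); [by have [_ _ + _] := aE m; exact..|].
  apply: (etrans (y := mkseq z (d m))).
    by apply/esym; apply: mkseq_le zw; exact: d_le.
  apply: (etrans (y := mkseq z' (d m))); last first.
    by apply: mkseq_le z'w'; exact: d_le.
  move: zu z'v; rewrite !mkseqD => /eqP; rewrite eqseq_cat ?size_mkseq ?tm//.
  move=> /andP[/eqP -> _] /eqP; rewrite eqseq_cat ?size_mkseq ?tm//.
  by move=> /andP[/eqP -> _].
have /eqP : t ++ u = t ++ v.
  by rewrite -zu -z'v -/k (prefix_k _ _ zw) (prefix_k _ _ z'w') ww'.
by rewrite eqseq_cat // eqxx => /eqP.
Qed.

(** * The sigma-ideal of non-refining families, and the collapse *)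

(** Countable counterexamples for all the pieces, together with [x], form one countable family. A
    member of [B] refining all of it lies in some piece because it refines [x], and contradicts the
    counterexample for that piece. *)
Lemma omega_refining_cover (B : set cantor_space) (I : countType)
    (A : I -> set cantor_space) x :
  infsets x -> omega_refining B ->
  (forall y, B y -> refines y x -> exists n, A n y) ->
  exists n, omega_refining (B `&` A n).
Proof.
move=> xinf Bref BA; apply: contrapT => /forallNP nref.
have /choice[C CP] : forall n, exists C : set cantor_space,
    [/\ C `<=` infsets, countable C &
        forall y, B y -> A n y -> exists2 x, C x & ~ refines y x].
  move=> n.
  have /existsNP[C /not_implyP[Cinf /not_implyP[Ccount nC]]] := nref n.
  exists C; split=> // y By Ay; apply: contrapT => /forall2NP yC; apply: nC.
  by exists y => // z Cz; have [//|/contrapT] := yC z.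
have [||y By yC] := Bref ([set x] `|` \bigcup_n C n).
- by move=> z [->//|[n _ Cz]]; have [+ _ _] := CP n; exact.
- rewrite -bigcup2E; apply: bigcup_countable => // i _; rewrite /bigcup2.
  case: i => [|[|i]]; first exact: finite_set_countable.
    by apply: bigcup_countable => [|n _]; [exact: countableP|have [] := CP n].
  exact: countable0.
have [n Ay] := BA y By (yC x (or_introl erefl)).
have [_ _ /(_ y By Ay)[z Cz]] := CP n; apply; apply: yC.
by right; exists n.
Qed.

(** Transparent, so that extending this condition unfolds to inclusion in [thin]. *)
Definition thin_condition : condition.
Proof.
by apply: (@Condition thin) => [y []||];
  [|exact: borel_thin|exact: thin_omega_refining].
Defined.

Definition graph (f : nat -> nat) : cantor_space :=
  fun i => if unpickle i is Some (m, n) then f m == n else false.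

Lemma graph_inj : injective graph.
Proof.
move=> f g fg; apply/funext => m; apply/esym/eqP.
have := congr1 (fun z : cantor_space => z (pickle (m, f m))) fg.
by rewrite /graph pickleK eqxx => <-.
Qed.

Theorem theorem7p13 :
  exists p : condition,
    forces stronger p
      (is_countable (check condition vomega) (check condition vbaire)).
Proof.
(* [n] is the number of a pair (m, t) from which every member of [q] recovers [f]. *)
pose D f n (q : condition) := exists2 i : nat * seq bool,
  n = pickle i & q `<=` codes (graph f) i.1 i.2.
exists thin_condition; apply: (@forces_is_countable _ _ _ _ D).
- by move=> p.
- by move=> p q r pq qr; exact: subset_trans qr.
- by move=> f n p q qp [i ni pi]; exists i => //; exact: subset_trans pi.
- move=> f g _ p [i -> pf] [j /(pcan_inj pickleK) <- pg].
  (* Refining the empty family shows that the condition has a member, from which both functions are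
     decoded. *)
  have [//|//|y py _] := family_refining p (C := set0).
  by apply/graph_inj/codes_inj; [exact: pf py|exact: pg py].
move=> f q qp.
(* The members of [q] that refine [indep (graph f)] are covered by the countably many pieces of
   constant code, so one piece is again a condition. *)
have [|i iref] := @omega_refining_cover q _
    (fun i : nat * seq bool => codes (graph f) i.1 i.2) _
    (@indep_infsets (graph f)) (family_refining q).
  by move=> y /qp /refines_codes H /H[m [t]]; exists (m, t).
have Iinf : q `&` codes (graph f) i.1 i.2 `<=` infsets.
  by move=> y [/(family_infsets (c := q))].
have Ibor := borel_setI (family_borel q) (@borel_codes (graph f) i.1 i.2).
exists (Condition Iinf Ibor iref); first exact: subIsetl.
by exists (pickle i), i => //; exact: subIsetr.
Qed.
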